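(* For every integer $n\ge 1$ there exists a plurifinely open set $\Omega\subset\mathbb{C}^n$ that is not a Borel subset of $\mathbb{C}^n$. Consequently, for every $n\geq 1$ it is not true that every plurifinely open set $\Omega\subset\mathbb{C}^n$ can be written as a countable union $\Omega=\bigcup_{j}\{z\in B_j:\varphi_j(z)>-1\}$, where each $B_j\subset\mathbb{C}^n$ is an open ball and each $\varphi_j$ is a negative plurisubharmonic function on $B_j$.
   Context: The plurifine topology on an open set $W\subset\mathbb{C}^n$ is the coarsest topology on $W$ that makes all plurisubharmonic functions on $W$ continuous (as maps into $[-\infty,+\infty)$). A set that is open in the plurifine topology is called plurifinely open. For $n=1$ this is the classical fine topology on $\mathbb{C}\cong\mathbb{R}^2$. Borel sets and open balls are understood with respect to the Euclidean topology. *)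

(* Defs.v *)
From HB Require Import structures.
From mathcomp Require Import all_boot all_order all_algebra.
From mathcomp Require Import complex.
From mathcomp Require Import all_classical all_reals all_analysis.

Set Implicit Arguments.
Unset Strict Implicit.
Unset Printing Implicit Defensive.

Import Order.TTheory GRing.Theory Num.Theory.
Import numFieldNormedType.Exports.

Local Open Scope classical_set_scope.
Local Open Scope ring_scope.
Local Open Scope complex_scope.

(* [R[i]] carries no topology in the library: it gets the one induced by the
   modulus, through [_^o], as every abstract [numFieldType] does. The row
   vectors ['rV[R[i]]_n] then carry the product topology, which is the
   Euclidean topology of C^n. *)
HB.instance Definition _ (R : rcfType) := GRing.ComAlgebra.copy R[i] R[i]^o.
HB.instance Definition _ (R : rcfType) := Vector.copy R[i] R[i]^o.
HB.instance Definition _ (R : rcfType) := NormedModule.copy R[i] R[i]^o.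

Section plurisubharmonic.
Context {R : realType}.
Implicit Types (U : set R[i]) (u : R[i] -> \bar R).

(* Upper semicontinuity at the points of an open set [W]; what [f] does
   outside [W] is irrelevant. *)
Definition usc_on {T : topologicalType} (W : set T) (f : T -> \bar R) :=
  forall z, W z -> forall a : R, (f z < a%:E)%E ->
    \forall y \near z, (f y < a%:E)%E.

Definition circle_point (a : R[i]) (r t : R) : R[i] :=
  a + ((r * cos t) +i* (r * sin t)).

(* Well defined in [-oo, +oo) when [u] is upper semicontinuous and < +oo on a
   neighbourhood of the circle, since [u] is then bounded above on it. *)
Definition circle_mean u (a : R[i]) (r : R) : \bar R :=
  (((2 * pi)^-1)%R%:E *
    \int[lebesgue_measure]_(t in `[0%R, (2 * pi)%R]) u (circle_point a r t))%E.

(* The value [-oo] is allowed, and so is the function identically [-oo]. *)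
Definition subharmonic U u :=
  [/\ forall z, U z -> (u z < +oo)%E,
      usc_on U u &
      forall (a : R[i]) (r : R), 0 < r ->
        [set z | `|z - a| <= r%:C] `<=` U -> (u a <= circle_mean u a r)%E].

Definition plurisubharmonic {n : nat} (W : set 'rV[R[i]]_n)
    (f : 'rV[R[i]]_n -> \bar R) :=
  [/\ forall z, W z -> (f z < +oo)%E,
      usc_on W f &
      forall a b : 'rV[R[i]]_n,
        subharmonic [set l | W (a + l *: b)] (fun l => f (a + l *: b))].

(* Coarsest topology on C^n making all plurisubharmonic functions on C^n
   continuous. As these never take the value [+oo], continuity into [\bar R]
   is continuity into [-oo, +oo). *)
Definition plurifine (n : nat) : Type :=
  sup_topology (fun f : {f : 'rV[R[i]]_n -> \bar R | plurisubharmonic setT f} =>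
    Topological.class (initial_topology (sval f))).

HB.instance Definition _ n := Topological.on (plurifine n).

Definition plurifinely_open {n : nat} (A : set 'rV[R[i]]_n) : Prop :=
  @open (plurifine n) A.

Definition borel_set {T : topologicalType} (A : set T) : Prop :=
  <<s @open T >> A.

(* The library's [ball] on row vectors is the one of the sup norm. *)
Definition euclidean_ball {n : nat} (c : 'rV[R[i]]_n) (r : R) :
    set 'rV[R[i]]_n :=
  [set z | \sum_i `|z 0 i - c 0 i| ^+ 2 < (r ^+ 2)%:C].

End plurisubharmonic.

Arguments plurifine : clear implicits.

(* Main.v *)
Require Import Defs.
From HB Require Import structures.
From mathcomp Require Import all_boot all_order all_algebra ring lra.
From mathcomp Require Import complex.
From mathcomp Require Import all_classical all_reals all_analysis.
From mathcomp Require Import measurable_realfun.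

(* Subsets of a polar set are invisible to the fine topology, so it suffices to
   find an uncountable polar set with a non-Borel subset. Let [e] embed the
   Cantor space 2^N in the real line by [e x = \sum_k x_k gap_k] with gaps so
   small that [e] has a polar image. For every [x] a weighted sum of
   regularised logarithmic potentials [ln (|w - c|^2 + d)], with nodes at all
   dyadic prefixes except those of [x], decreases to a subharmonic function
   [v_x] of the plane that is finite at [e x] and [-oo] at [e y] for [y != x].
   For any [S] in 2^N the plurifinely open set [\bigcup_(x in S) {v_x(z_1) > -oo}]
   meets the image of [e] (in the first coordinate) exactly in [e @` S]. If it is
   Borel then so is [S]; Borel codes inject into 2^N, hence a diagonal argument
   yields an [S] which is not Borel. Finally, the sets [{z in B : phi z > -1}] are
   Borel since [phi] is upper semicontinuous. *)

Set Implicit Arguments.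
Unset Strict Implicit.
Unset Printing Implicit Defensive.

Import Order.TTheory GRing.Theory Num.Theory.
Import numFieldNormedType.Exports.

Local Open Scope classical_set_scope.
Local Open Scope ring_scope.
Local Open Scope complex_scope.

(** * Integrals of continuous functions over segments *)

Section log_integral.
Context {R : realType}.
Local Notation mu := (@lebesgue_measure R).
Implicit Types (f g G : R -> R).

Lemma continuous_itv_integrable f (a b : R) : continuous f ->
  mu.-integrable `[a, b] (EFin \o f).
Proof.
move=> cf; apply: continuous_compact_integrable; first exact: segment_compact.
exact: continuous_subspaceT.
Qed.

Lemma Rintegral_affine G (k c a b : R) : 0 < k -> a <= b -> continuous G ->
  \int[mu]_(x in `[k * a + c, k * b + c]) G x =
  k * \int[mu]_(x in `[a, b]) G (k * x + c).
Proof.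
move=> k0 ab cG.
pose F (x : R) := k * x + c.
have dF (x : R) : is_derive x 1 F k.
  rewrite (_ : F = k *: (id : R -> R) + cst c) //.
  by apply: is_derive_eq; rewrite addr0 /GRing.scale/= mulr1.
have F' : derive1 F = cst k by apply/funext => x; rewrite derive1E derive_val.
have cF : continuous F.
  move=> x; apply/differentiable_continuous/derivable1_diffP.
  by have [] := dF x.
rewrite -RintegralZl//; last first.
  by apply: continuous_itv_integrable => x; apply: continuous_comp; [exact: cF|exact: cG].
rewrite /Rintegral -[k * a + c]/(F a) -[k * b + c]/(F b).
rewrite (@integration_by_substitution_increasing _ F)//.
- congr fine; apply: eq_integral => x _; congr EFin.
  by rewrite F' /= /F mulrC.
- by move=> x y _ _ xy; rewrite /F ltrD2r ltr_pM2l.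
- by rewrite F' => x _; exact: cst_continuous.
- by rewrite F'; exact: is_cvg_cst.
- by rewrite F'; exact: is_cvg_cst.
- split.
  + by move=> x _; have [] := dF x.
  + by apply: cvg_at_right_filter; exact: cF.
  + by apply: cvg_at_left_filter; exact: cF.
- exact: continuous_subspaceT.
Qed.

Lemma Rintegral_itv_split f (a b c : R) : a <= b -> b <= c -> continuous f ->
  \int[mu]_(x in `[a, c]) f x =
  \int[mu]_(x in `[a, b]) f x + \int[mu]_(x in `[b, c]) f x.
Proof.
move=> ab bc cf.
rewrite -(@Rintegral_itv_obnd_cbnd _ b); last first.
  by apply: integrableS (continuous_itv_integrable b c cf) => //; exact: subset_itv_oc_cc.
rewrite -(@Rintegral_itvB _ f (BLeft a) (BRight c) b)//.
- by rewrite addrC subrK.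
- exact: continuous_itv_integrable.
Qed.

(** * The mean of a logarithm over a circle *)

Definition trig1 (A C D t : R) := A + C * cos t + D * sin t.

Definition log_trig1_int (A C D : R) :=
  \int[mu]_(t in `[0, 2 * pi]) ln (trig1 A C D t).

Lemma trig1_ge (A C D r t : R) : 0 <= r -> C ^+ 2 + D ^+ 2 = r ^+ 2 ->
  A - r <= trig1 A C D t.
Proof.
move=> r0 CDr; rewrite /trig1 -addrA lerD2l.
have h : (C * cos t + D * sin t) ^+ 2 <= r ^+ 2.
  have := cos2Dsin2 t; move: (cos t) (sin t) => x y xy.
  (* Lagrange's identity: [(C x + D y)^2] and [(C y - D x)^2] add up to
     [(C^2 + D^2) (x^2 + y^2)]. *)
  rewrite -CDr -subr_ge0 [leRHS](_ : _ = (C * y - D * x) ^+ 2); first exact: sqr_ge0.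
  by rewrite -[C ^+ 2 + D ^+ 2]mulr1 -xy; ring.
by move: h; rewrite -real_normK ?num_real ?ler_sqr ?nnegrE// ler_norml => /andP[].
Qed.

Lemma continuous_log_trig1 (A C D r : R) : 0 <= r -> C ^+ 2 + D ^+ 2 = r ^+ 2 ->
  r < A -> continuous (fun t => ln (trig1 A C D t)).
Proof.
move=> r0 CDr rA t; apply: (@continuous_comp _ _ _ (trig1 A C D) (@ln R) t); last first.
  by apply: continuous_ln; apply: lt_le_trans (trig1_ge A t r0 CDr); rewrite subr_gt0.
rewrite /trig1; apply: cvgD; [apply: cvgD; first exact: cvg_cst|].
  by apply: cvgM; [exact: cvg_cst|exact: continuous_cos].
by apply: cvgM; [exact: cvg_cst|exact: continuous_sin].
Qed.

(* Pair the values at [t] and [t + pi]: their product is again a trigonometric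
   polynomial of degree one, in the angle [2 t]. *)
Lemma log_trig1_int_doubling (A C D r : R) : 0 <= r -> C ^+ 2 + D ^+ 2 = r ^+ 2 ->
  r < A ->
  2 * log_trig1_int A C D =
  log_trig1_int (A ^+ 2 - r ^+ 2 / 2) (- ((C ^+ 2 - D ^+ 2) / 2)) (- (C * D)).
Proof.
move=> r0 CDr rA.
have CDr' : (- C) ^+ 2 + (- D) ^+ 2 = r ^+ 2 by rewrite !sqrrN.
have cf := continuous_log_trig1 r0 CDr rA.
have cg := continuous_log_trig1 r0 CDr' rA.
have pi0 : 0 <= pi :> R := pi_ge0 R.
have tE t : trig1 A C D t * trig1 A (- C) (- D) t =
  trig1 (A ^+ 2 - r ^+ 2 / 2) (- ((C ^+ 2 - D ^+ 2) / 2)) (- (C * D)) (2 * t + 0).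
  rewrite /trig1 addr0 mulr_natl cos_mulr2n sin_mulr2n -CDr.
  have := sin2cos2 t; move: (cos t) (sin t) => x y xy.
  have -> : (A + C * x + D * y) * (A + - C * x + - D * y) =
    A ^+ 2 - C ^+ 2 * x ^+ 2 - D ^+ 2 * y ^+ 2 - C * D * (x * y *+ 2) by ring.
  by rewrite xy; field.
have rA' : r ^+ 2 / 2 < A ^+ 2 - r ^+ 2 / 2.
  by rewrite ltrBrDr -splitr ltr_pXn2r// nnegrE// ltW// (le_lt_trans r0).
have r'0 : 0 <= r ^+ 2 / 2 by rewrite divr_ge0// sqr_ge0.
have CDr2 : (- ((C ^+ 2 - D ^+ 2) / 2)) ^+ 2 + (- (C * D)) ^+ 2 = (r ^+ 2 / 2) ^+ 2.
  by rewrite -CDr; field.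
have ch := continuous_log_trig1 r'0 CDr2 rA'.
rewrite [in RHS]/log_trig1_int -[X in `[X, _]](addr0 0) -[X in `[X + _, _]](mulr0 2).
rewrite -[X in `[_, X]]addr0 Rintegral_affine//; congr (2 * _).
rewrite /log_trig1_int (@Rintegral_itv_split _ 0 pi)//; last by rewrite mulr_natl mulr2n lerDl.
have -> : `[pi, 2 * pi] = `[1 * 0 + pi, 1 * pi + pi] :> interval R.
  by rewrite mulr0 add0r mul1r mulr_natl mulr2n.
rewrite Rintegral_affine// mul1r -RintegralD//; last 2 first.
- exact: continuous_itv_integrable.
- apply: continuous_itv_integrable.
  suff -> : (fun x => ln (trig1 A C D (1 * x + pi))) = (fun t => ln (trig1 A (- C) (- D) t)) by [].
  by apply/funext => x; rewrite /trig1 mul1r cosDpi sinDpi !mulrN !mulNr.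
apply: eq_Rintegral => t _; rewrite -tE lnM ?posrE.
- by congr (_ + ln _); rewrite /trig1 mul1r cosDpi sinDpi !mulrN !mulNr.
- by apply: lt_le_trans (trig1_ge A t r0 CDr); rewrite subr_gt0.
- by apply: lt_le_trans (trig1_ge A t r0 CDr'); rewrite subr_gt0.
Qed.

(** The crude bound by the minimum of the integrand. It becomes sharp after repeated doubling, as
    the ratio of [r] to [A] then tends to 0. *)
Lemma log_trig1_int_ge (A C D r : R) : 0 <= r -> C ^+ 2 + D ^+ 2 = r ^+ 2 -> r < A ->
  2 * pi * ln (A - r) <= log_trig1_int A C D.
Proof.
move=> r0 CDr rA.
have -> : 2 * pi * ln (A - r) = \int[mu]_(t in `[0, 2 * pi]) (ln (A - r)).
  rewrite Rintegral_cst// [X in fine X]lebesgue_measure_itv/= lte_fin pmulr_rgt0// pi_gt0/=.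
  by rewrite subr0 mulrC.
apply: le_Rintegral => //.
- by apply: continuous_itv_integrable => x; exact: cvg_cst.
- apply: continuous_itv_integrable; exact: continuous_log_trig1 rA.
- move=> t _; rewrite ler_ln ?posrE ?subr_gt0//; first exact: trig1_ge.
  by apply: lt_le_trans (trig1_ge A t r0 CDr); rewrite subr_gt0.
Qed.

(* [p^2 + q^2 + 2 p q cos t = |p + q e^(it)|^2], and doubling replaces the pair
   [(p, q)] by [(p^2, q^2)]. *)
Lemma log_trig1_int_iter_ge k (p q C D : R) : 0 <= q -> q < p ->
  C ^+ 2 + D ^+ 2 = (2 * p * q) ^+ 2 ->
  2 * pi * (2 * ln (p ^+ (2 ^ k) - q ^+ (2 ^ k))) <=
  2 ^+ k * log_trig1_int (p ^+ 2 + q ^+ 2) C D.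
Proof.
elim: k p q C D => [|k IH] p q C D q0 qp CD.
  have p0 := le_lt_trans q0 qp.
  rewrite expn0 expr0 !expr1 mul1r.
  rewrite (_ : 2 * ln (p - q) = ln (p ^+ 2 + q ^+ 2 - 2 * p * q)); last first.
    have -> : p ^+ 2 + q ^+ 2 - 2 * p * q = (p - q) ^+ 2 by ring.
    by rewrite lnXn ?subr_gt0// mulr_natl.
  apply: log_trig1_int_ge => //; first by rewrite !mulr_ge0// ltW.
  by rewrite -subr_gt0 (_ : _ - _ = (p - q) ^+ 2) ?exprn_gt0 ?subr_gt0//; ring.
have p0 := le_lt_trans q0 qp.
rewrite [2 ^+ k.+1]exprSr -[leRHS]mulrA (@log_trig1_int_doubling _ _ _ (2 * p * q))//; last 2 first.
- by rewrite !mulr_ge0// ltW.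
- by rewrite -subr_gt0 (_ : _ - _ = (p - q) ^+ 2) ?exprn_gt0 ?subr_gt0//; ring.
rewrite expnS !exprM.
rewrite (_ : (p ^+ 2 + q ^+ 2) ^+ 2 - _ = (p ^+ 2) ^+ 2 + (q ^+ 2) ^+ 2); last by field.
apply: IH.
- exact: sqr_ge0.
- by rewrite ltr_pXn2r// nnegrE ltW.
- rewrite (_ : (2 * p ^+ 2 * q ^+ 2) ^+ 2 = ((2 * p * q) ^+ 2 / 2) ^+ 2); last by field.
  by rewrite -CD; field.
Qed.

(** Half of Jensen's formula for [p + q e^(it)]. After division by [2^k], the bound of
    [log_trig1_int_iter_ge] tends to the one claimed, because [q^(2^k)] is negligible against
    [p^(2^k)]. *)
Lemma log_trig1_int_ge_ln (p q C D : R) : 0 <= q -> q < p ->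
  C ^+ 2 + D ^+ 2 = (2 * p * q) ^+ 2 ->
  2 * pi * ln (p ^+ 2) <= log_trig1_int (p ^+ 2 + q ^+ 2) C D.
Proof.
move=> q0 qp CD.
have p0 := le_lt_trans q0 qp.
set L := log_trig1_int _ _ _.
(* With [N = 2^k], [(q/p)^N <= q/p]: replacing [p^N - q^N] by [p^N] changes the logarithm by at most
   [- ln (1 - q/p)], uniformly in [k]. *)
have step k : ln (p - q) - ln p <= ln (p ^+ (2 ^ k) - q ^+ (2 ^ k)) - 2 ^+ k * ln p.
  have [n nE] : exists n, (2 ^ k)%N = n.+1.
    by exists (2 ^ k).-1; rewrite prednK// expn_gt0.
  have pqn : q ^+ n.+1 < p ^+ n.+1 by rewrite ltr_pXn2r// nnegrE ltW.
  rewrite -natrX nE mulr_natl -lnXn// -!ln_div ?posrE ?subr_gt0 ?exprn_gt0//.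
  rewrite ler_ln ?posrE ?divr_gt0 ?exprn_gt0 ?subr_gt0//.
  rewrite ler_pdivrMr// mulrAC ler_pdivlMr ?exprn_gt0//.
  rewrite -subr_ge0 (_ : _ - _ = q * p * (p ^+ n - q ^+ n)); last by rewrite !exprS; ring.
  apply: mulr_ge0; first by rewrite mulr_ge0// ltW.
  by rewrite subr_ge0 lerXn2r ?nnegrE// ltW.
have h k : 2 * pi * (2 * (ln (p - q) - ln p)) <= 2 ^+ k * (L - 2 * pi * ln (p ^+ 2)).
  have := log_trig1_int_iter_ge k q0 qp CD; rewrite -/L => hk.
  rewrite [leRHS]mulrBr; apply: le_trans (lerB hk (lexx _)).
  rewrite lnXn//.
  rewrite [leRHS](_ : _ =
    2 * pi * (2 * (ln (p ^+ (2 ^ k) - q ^+ (2 ^ k)) - 2 ^+ k * ln p))); last by ring.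
  by rewrite ler_pM2l ?mulr_gt0 ?pi_gt0// ler_pM2l.
(* A negative [X] is impossible: [2^k * X] would fall below the constant [K]. *)
rewrite -subr_ge0 leNgt; apply/negP => X0.
set X := L - _ in h X0; set K := 2 * pi * _ in h.
have [k hk] : exists k, K / X < 2 ^+ k.
  exists (Num.bound `|K / X|); apply: le_lt_trans (ler_norm _) _.
  apply: lt_le_trans (archi_boundP (normr_ge0 _)) _.
  by rewrite -natrX ler_nat; exact/ltnW/ltn_expl.
by have := h k; rewrite leNgt -ltr_ndivrMr// hk.
Qed.

Definition log_sq (d x y : R) := ln (x ^+ 2 + y ^+ 2 + d).

(** With [a = |p|] and [b = |q|], the integrand is the logarithm of [A] plus a trigonometric term of
    amplitude [r = 2 a b]. Writing [A = P^2 + Q^2] and [r = 2 P Q] bounds the mean below by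
    [ln (P^2)], and [P^2 >= a^2 + d]. *)
Lemma log_sq_submean (d p1 p2 q1 q2 : R) : 0 < d ->
  2 * pi * log_sq d p1 p2 <=
  \int[mu]_(t in `[0, 2 * pi]) log_sq d (p1 + (q1 * cos t - q2 * sin t))
                                        (p2 + (q1 * sin t + q2 * cos t)).
Proof.
move=> d0.
pose a := Num.sqrt (p1 ^+ 2 + p2 ^+ 2); pose b := Num.sqrt (q1 ^+ 2 + q2 ^+ 2).
have aE : a ^+ 2 = p1 ^+ 2 + p2 ^+ 2 by rewrite sqr_sqrtr// addr_ge0 ?sqr_ge0.
have bE : b ^+ 2 = q1 ^+ 2 + q2 ^+ 2 by rewrite sqr_sqrtr// addr_ge0 ?sqr_ge0.
have a0 : 0 <= a := sqrtr_ge0 _.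
have b0 : 0 <= b := sqrtr_ge0 _.
pose A := a ^+ 2 + b ^+ 2 + d; pose r := 2 * a * b.
have r0 : 0 <= r by rewrite !mulr_ge0.
have rA : r < A.
  rewrite -subr_gt0 (_ : _ - _ = (a - b) ^+ 2 + d); last by rewrite /A /r; ring.
  by rewrite ltr_wpDl// sqr_ge0.
have Ar0 : 0 < A + r by rewrite ltr_wpDr// (le_lt_trans r0).
pose s := Num.sqrt (A + r); pose s' := Num.sqrt (A - r).
have sE : s ^+ 2 = A + r by rewrite sqr_sqrtr// ltW.
have s'E : s' ^+ 2 = A - r by rewrite sqr_sqrtr// subr_ge0 ltW.
have s'0 : 0 < s' by rewrite sqrtr_gt0 subr_gt0.
have ss' : s' <= s by rewrite ler_wsqrtr// lerD2l ge0_cp.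
(* [P + Q = s] and [P - Q = s'] are forced by [(P + Q)^2 = A + r] and [(P - Q)^2 = A - r]. *)
pose P := (s + s') / 2; pose Q := (s - s') / 2.
have Q0 : 0 <= Q by rewrite divr_ge0// subr_ge0.
have QP : Q < P by rewrite /Q /P; lra.
have PQA : P ^+ 2 + Q ^+ 2 = A.
  have -> : P ^+ 2 + Q ^+ 2 = (s ^+ 2 + s' ^+ 2) / 2 by rewrite /P /Q; field.
  by rewrite sE s'E; field.
have PQr : 2 * P * Q = r.
  have -> : 2 * P * Q = (s ^+ 2 - s' ^+ 2) / 2 by rewrite /P /Q; field.
  by rewrite sE s'E; field.
(* [P^2] and [Q^2] are the roots of [T^2 - A T + r^2 / 4]. At [T = b^2] this polynomial equals
   [- d b^2 <= 0], so [b^2] cannot lie below the smaller root [Q^2]. *)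
have Qb : Q ^+ 2 <= b ^+ 2.
  rewrite leNgt; apply/negP => bQ.
  have bP : b ^+ 2 < P ^+ 2.
    by apply: lt_trans bQ _; rewrite ltr_pXn2r// nnegrE// (le_trans Q0)// ltW.
  have : 0 < (P ^+ 2 - b ^+ 2) * (Q ^+ 2 - b ^+ 2) by rewrite mulr_gt0// subr_gt0.
  have -> : (P ^+ 2 - b ^+ 2) * (Q ^+ 2 - b ^+ 2) =
    (2 * P * Q) ^+ 2 / 4 - b ^+ 2 * (P ^+ 2 + Q ^+ 2) + b ^+ 2 * b ^+ 2 by field.
  rewrite PQA PQr (_ : _ + _ = - (d * b ^+ 2)); last by rewrite /A /r; field.
  by rewrite ltNge oppr_le0 mulr_ge0 ?sqr_ge0 ?ltW.
have aP : a ^+ 2 + d <= P ^+ 2 by move: PQA Qb; rewrite /A; lra.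
have CD : (2 * (p1 * q1 + p2 * q2)) ^+ 2 + (2 * (p2 * q1 - p1 * q2)) ^+ 2 = (2 * P * Q) ^+ 2.
  rewrite PQr /r (_ : (2 * a * b) ^+ 2 = 4 * a ^+ 2 * b ^+ 2); last by ring.
  by rewrite aE bE; ring.
apply: (@le_trans _ _ (2 * pi * ln (P ^+ 2))).
  have ad0 : 0 < a ^+ 2 + d by rewrite ltr_wpDl// sqr_ge0.
  rewrite ler_pM2l ?mulr_gt0 ?pi_gt0//= /log_sq -aE ler_ln ?posrE//.
  exact: lt_le_trans aP.
apply: le_trans (log_trig1_int_ge_ln Q0 QP CD) _.
rewrite le_eqVlt; apply/orP; left; apply/eqP.
apply: eq_Rintegral => t _; rewrite /log_sq; congr ln.
rewrite PQA /trig1 /A aE bE.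
have := sin2cos2 t; move: (cos t) (sin t) => x y xy.
transitivity (p1 ^+ 2 + p2 ^+ 2 + d + (q1 ^+ 2 + q2 ^+ 2) * (x ^+ 2 + y ^+ 2) +
  2 * (p1 * q1 + p2 * q2) * x + 2 * (p2 * q1 - p1 * q2) * y); last by ring.
by rewrite xy; ring.
Qed.

Lemma continuous_log_sq (T : topologicalType) (d : R) (f g : T -> R) (t : T) :
  0 < d -> {for t, continuous f} -> {for t, continuous g} ->
  {for t, continuous (fun t => log_sq d (f t) (g t))}.
Proof.
move=> d0 cf cg.
apply: (@continuous_comp _ _ _ (fun t => f t ^+ 2 + g t ^+ 2 + d) (@ln R) t).
  apply: cvgD; last exact: cvg_cst.
  by apply: cvgD; rewrite expr2; [apply: cvgM|apply: cvgM].
by apply: continuous_ln; rewrite ltr_wpDl// addr_ge0// sqr_ge0.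
Qed.

End log_integral.

(** * Submean inequalities and their decreasing limits *)

Section submean.
Context {R : realType}.
Local Notation mu := (@lebesgue_measure R).

(** Monotone convergence for the nonnegative increasing differences [h 0 - h n]. Since the integral
    of [h 0] is finite and [c] bounds every integral from below, the limit [G] of the differences is
    integrable and can be subtracted back. *)
Lemma integral_inf_ge (h : nat -> R -> R) (a b : R) (c : \bar R) :
  (forall n, continuous (h n)) ->
  (forall n t, h n.+1 t <= h n t) ->
  (forall n, (c <= \int[mu]_(t in `[a, b]) (h n t)%:E)%E) ->
  (c <= \int[mu]_(t in `[a, b]) ereal_inf (range (fun n => (h n t)%:E)))%E.
Proof.
move=> ch dh ich.
have ih n : mu.-integrable `[a, b] (EFin \o h n) by exact: continuous_itv_integrable.
have fh n : (\int[mu]_(t in `[a, b]) (h n t)%:E)%E \is a fin_num.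
  exact: integrable_fin_num (ih n).
case: c ich => [c| |] ich; last by rewrite leNye.
  2: by have := ich 0; rewrite leye_eq => /eqP e; move: (fh 0); rewrite e.
set V := fun t => ereal_inf (range (fun n => (h n t)%:E)).
have dh' t : {homo (fun n => h n t) : m n / (m <= n)%N >-> n <= m}.
  by apply/nonincreasing_seqP => n; exact: dh.
have cV t : (fun n => (h n t)%:E) @ \oo --> V t.
  by apply: ereal_nonincreasing_cvgn => m n mn; rewrite lee_fin; exact: dh'.
pose g n t : \bar R := ((h 0 t)%:E - (h n t)%:E)%E.
pose G t : \bar R := ((h 0 t)%:E - V t)%E.
have gG t : g^~ t @ \oo --> G t.
  by apply: cvgeB => //; exact: cvg_cst.
have g0 n t : (0 <= g n t)%E by rewrite /g -EFinB lee_fin subr_ge0; exact: dh'.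
have mg n : measurable_fun (`[a, b] : set R) (g n : _ -> \bar R).
  apply: measurable_funTS; apply/measurable_EFinP.
  by apply: measurable_funB; exact: continuous_measurable_fun.
have GE t : G t = limn (g^~ t) by apply/esym/cvg_lim => //; exact: gG.
have IG : (\int[mu]_(t in `[a, b]) g n t)%E @[n --> \oo] --> (\int[mu]_(t in `[a, b]) G t)%E.
  under eq_integral do rewrite GE.
  apply: cvg_monotone_convergence => //.
  by move=> t _ m n mn; rewrite /g -!EFinB lee_fin lerD2l lerN2; exact: dh'.
have IGle : (\int[mu]_(t in `[a, b]) G t <= \int[mu]_(t in `[a, b]) (h 0 t)%:E - c%:E)%E.
  apply: (cvge_to_le IG); apply: nearW => n.
  by rewrite /g integralB_EFin// leeB.
have mG : measurable_fun (`[a, b] : set R) (G : _ -> \bar R).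
  apply: (emeasurable_fun_cvg g) => // t _; exact: gG.
have G0 t : (0 <= G t)%E by apply: (cvge_to_ge (gG t)); exact: nearW.
have iG : mu.-integrable `[a, b] G.
  apply/integrableP; split => //.
  under eq_integral do rewrite gee0_abs//.
  by apply: le_lt_trans IGle _; rewrite ltey_eq fin_numB fh.
(* This also covers the points where [V t = -oo], that is [G t = +oo]. *)
have VE t : V t = ((h 0 t)%:E - G t)%E.
  rewrite /G; case: (V t) => [v| |] //=.
  by rewrite -!EFinB opprB addrC subrK.
under eq_integral do rewrite -/(V _) VE.
rewrite (integralB _ (ih 0) iG)//.
have fG : (\int[mu]_(t in `[a, b]) G t)%E \is a fin_num by exact: integrable_fin_num iG.
move: IGle; rewrite -(fineK fG) -(fineK (fh 0)) -!EFinB !lee_fin; lra.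
Qed.

(* Circles are replaced by their images under arbitrary, possibly constant, affine
   maps: this makes the condition stable under restriction to complex lines. *)
Definition submean (F : R -> R -> R) :=
  continuous (fun z : R * R => F z.1 z.2) /\
  forall p1 p2 q1 q2, 2 * pi * F p1 p2 <=
    \int[mu]_(t in `[0, 2 * pi]) F (p1 + (q1 * cos t - q2 * sin t))
                                   (p2 + (q1 * sin t + q2 * cos t)).

Lemma continuous_submean F (T : topologicalType) (f g : T -> R) (t : T) :
  submean F -> {for t, continuous f} -> {for t, continuous g} ->
  {for t, continuous (fun t => F (f t) (g t))}.
Proof.
move=> [cF _] cf cg.
apply: (@continuous_comp _ _ _ (fun t => (f t, g t)) (fun z => F z.1 z.2) t); last exact: cF.
by apply: (@cvg_pair _ _ _ (nbhs t) (nbhs (f t)) (nbhs (g t))).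
Qed.

Lemma continuous_submean_circle F p1 p2 q1 q2 : submean F ->
  continuous (fun t => F (p1 + (q1 * cos t - q2 * sin t))
                         (p2 + (q1 * sin t + q2 * cos t))).
Proof.
move=> sF t.
have cM (k : R) (f : R -> R) : continuous f -> {for t, continuous (fun t => k * f t)}.
  by move=> cf; apply: cvgM; [exact: cvg_cst|exact: cf].
have cs := @continuous_sin R; have cc := @continuous_cos R.
apply: continuous_submean => //.
  by apply: cvgD; [exact: cvg_cst|apply: cvgB; exact: cM].
by apply: cvgD; [exact: cvg_cst|apply: cvgD; exact: cM].
Qed.

Lemma submean_log_sq (c d : R) : 0 < d -> submean (fun x y => log_sq d (x - c) y).
Proof.
move=> d0; split=> [z|p1 p2 q1 q2].
  apply: (@continuous_log_sq _ _ d (fun z : R * R => z.1 - c) snd z d0).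
    by apply: cvgB; [exact: cvg_fst|exact: cvg_cst].
  exact: cvg_snd.
apply: le_trans (log_sq_submean (p1 - c) p2 q1 q2 d0) _.
by under [leRHS]eq_Rintegral do rewrite addrAC.
Qed.

Lemma submeanD F G : submean F -> submean G -> submean (fun x y => F x y + G x y).
Proof.
move=> sF sG; split=> [z|p1 p2 q1 q2].
  by apply: cvgD; [exact: sF.1|exact: sG.1].
rewrite RintegralD//; [|exact/continuous_itv_integrable/continuous_submean_circle..].
by rewrite mulrDr lerD//; [exact: sF.2|exact: sG.2].
Qed.

Lemma submeanZ F (k : R) : 0 <= k -> submean F -> submean (fun x y => k * F x y).
Proof.
move=> k0 sF; split=> [z|p1 p2 q1 q2].
  by apply: cvgM; [exact: cvg_cst|exact: sF.1].
rewrite RintegralZl//; last exact/continuous_itv_integrable/continuous_submean_circle.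
by rewrite mulrCA ler_wpM2l//; exact: sF.2.
Qed.

Lemma submean_cst (k : R) : submean (fun _ _ => k).
Proof.
split=> [z|p1 p2 q1 q2]; first exact: cvg_cst.
rewrite Rintegral_cst// [X in fine X]lebesgue_measure_itv/= lte_fin.
by rewrite pmulr_rgt0// pi_gt0/= subr0 mulrC.
Qed.

Lemma submean_sum (I : Type) (r : seq I) (P : pred I) (F : I -> R -> R -> R) :
  (forall i, P i -> submean (F i)) -> submean (fun x y => \sum_(i <- r | P i) F i x y).
Proof.
move=> sF; elim: r => [|i r IH].
  rewrite (_ : (fun x y => _) = (fun _ _ => 0)); first exact: submean_cst.
  by apply/funext => x; apply/funext => y; rewrite big_nil.
have [Pi|Pi] := boolP (P i).
  rewrite (_ : (fun x y => _) = (fun x y => F i x y + \sum_(i <- r | P i) F i x y)).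
    by apply: submeanD => //; exact: sF.
  by apply/funext => x; apply/funext => y; rewrite big_cons Pi.
rewrite (_ : (fun x y => _) = (fun x y => \sum_(i <- r | P i) F i x y))//.
by apply/funext => x; apply/funext => y; rewrite big_cons (negPf Pi).
Qed.

End submean.

(** * The Cantor set and its potentials *)

Section cantor_points.
Context {R : realType}.
Implicit Types (x y : nat -> bool) (m n k : nat).

(* The growth makes both [\sum_m 2^m loggap_(m-1) / loggap_m] and
   [\sum_m 2^m / loggap_m] converge. *)
Fixpoint loggap m : R := if m is k.+1 then 8 * 4 ^+ k * loggap k else 2.

Definition gap m : R := expR (- loggap m).

Lemma loggap_ge m : 2 * 4 ^+ m <= loggap m.
Proof.
elim: m => [|m IH] /=; first by rewrite expr0 mulr1.
have h4 : 1 <= 4 ^+ m :> R by rewrite exprn_ege1// ler1n.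
rewrite exprS; move: IH h4; move: (loggap m) (4 ^+ m) => L u Lu u1; nra.
Qed.

Lemma loggap_gt0 m : 0 < loggap m.
Proof. by apply: lt_le_trans (loggap_ge m); rewrite mulr_gt0// exprn_gt0. Qed.

Lemma loggap_ge2 m : 2 <= loggap m.
Proof.
by apply: le_trans (loggap_ge m); rewrite -[leLHS]mulr1 ler_wpM2l// exprn_ege1// ler1n.
Qed.

Lemma gap_gt0 m : 0 < gap m. Proof. exact: expR_gt0. Qed.

Lemma gap_small (e : R) : 0 < e -> exists k, gap k < e.
Proof.
move=> e0; exists (Num.bound e^-1).
set k := Num.bound _.
have k0 : 0 < loggap k :> R := loggap_gt0 k.
apply: (@le_lt_trans _ _ (loggap k)^-1).
  rewrite /gap expRN lef_pV2 ?posrE ?expR_gt0//.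
  by apply: le_trans (expR_ge1Dx _); rewrite lerDr.
rewrite invf_plt ?posrE//; apply: (@lt_le_trans _ _ k%:R).
  by apply: archi_boundP; rewrite invr_ge0 ltW.
apply: le_trans (loggap_ge k).
rewrite -natrX -natrM ler_nat; apply: leq_trans (ltnW (ltn_expl k (isT : 1 < 4)%N)) _.
by rewrite leq_pmull.
Qed.

Lemma expR_ge4 : 4 <= expR 2 :> R.
Proof.
have -> : 2 = 1 + 1 :> R by ring.
rewrite expRD; have := @expR_ge1Dx R 1; move: (expR 1) => e; nra.
Qed.

Lemma gapS m : gap m.+1 <= gap m / 4.
Proof.
have h4 : 1 <= 4 ^+ m :> R by rewrite exprn_ege1// ler1n.
have L2 := loggap_ge2 m.
have : gap m.+1 <= expR (- loggap m - 2).
  by rewrite ler_expR /=; move: (loggap m) (4 ^+ m) h4 L2 => L u; nra.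
move/le_trans; apply; rewrite expRD ler_wpM2l ?expR_ge0// expRN.
by rewrite lef_pV2 ?posrE ?expR_gt0// expR_ge4.
Qed.

Lemma gap_le m : gap m <= 4^-1.
Proof.
elim: m => [|m IH]; last by have := gapS m; have := gap_gt0 m; lra.
by rewrite /gap/= expRN lef_pV2 ?posrE ?expR_gt0// expR_ge4.
Qed.

Definition cantor_psum x n : R := \sum_(k < n) (x k)%:R * gap k.

Definition cantor_point x : R := sup (range (cantor_psum x)).

Lemma cantor_psumS x n : cantor_psum x n.+1 = cantor_psum x n + (x n)%:R * gap n.
Proof. by rewrite /cantor_psum big_ord_recr. Qed.

Lemma eq_cantor_psum x y n : (forall i, (i < n)%N -> x i = y i) ->
  cantor_psum x n = cantor_psum y n.
Proof. by move=> xy; apply: eq_bigr => i _; rewrite xy. Qed.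

Lemma cantor_psum_ge x n j : cantor_psum x n <= cantor_psum x (n + j).
Proof.
elim: j => [|j IH]; first by rewrite addn0.
apply: le_trans IH _; rewrite addnS cantor_psumS lerDl.
by rewrite mulr_ge0// ltW// gap_gt0.
Qed.

(** The constant 4/3 is the sum of the geometric series of ratio 1/4 from [gapS]:
    [gap n + 4/3 * (gap n / 4) = 4/3 * gap n]. The right-hand side thus bounds all later partial
    sums. *)
Lemma cantor_psum_le x n j :
  cantor_psum x (n + j) + 4 / 3 * gap (n + j) <= cantor_psum x n + 4 / 3 * gap n.
Proof.
elim: j => [|j IH]; first by rewrite addn0.
apply: le_trans IH; rewrite addnS cantor_psumS.
have := gapS (n + j); have := gap_gt0 (n + j).
by case: (x _); rewrite /= ?mul1r ?mul0r; lra.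
Qed.

Lemma cantor_point_bounds x n :
  cantor_psum x n <= cantor_point x <= cantor_psum x n + 4 / 3 * gap n.
Proof.
have ub k : cantor_psum x k <= cantor_psum x n + 4 / 3 * gap n.
  have [nk|kn] := leqP n k.
    have := cantor_psum_le x n (k - n); rewrite subnKC//.
    by have := gap_gt0 k; lra.
  have := cantor_psum_ge x k (n - k); rewrite subnKC ?(ltnW kn)//.
  by have := gap_gt0 n; lra.
apply/andP; split.
  apply: ub_le_sup; last by exists n.
  by exists (cantor_psum x n + 4 / 3 * gap n) => _ [k _ <-].
apply: ge_sup; first by exists (cantor_psum x n); exists n.
by move=> _ [k _ <-].
Qed.

Lemma cantor_point_dist_le x y n : (forall i, (i < n)%N -> x i = y i) ->
  `|cantor_point x - cantor_point y| <= 4 / 3 * gap n.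
Proof.
move=> /eq_cantor_psum xy.
have := cantor_point_bounds x n; have := cantor_point_bounds y n; rewrite xy.
by move=> /andP[? ?] /andP[? ?]; rewrite ler_norml; apply/andP; split; lra.
Qed.

(** The digit at [n] contributes [gap n], while the later digits make up at most
    [4/3 * gap n.+1 <= gap n / 3]. *)
Lemma cantor_point_dist_ge x y n : (forall i, (i < n)%N -> x i = y i) -> x n != y n ->
  2 / 3 * gap n <= `|cantor_point x - cantor_point y|.
Proof.
wlog : x y / ~~ x n.
  move=> H xy xyn; case xnE : (x n) => //.
    rewrite distrC; apply: H; [|by move=> i /xy|by rewrite eq_sym].
    by move: xyn; rewrite xnE; case: (y n).
  by apply: H => //; rewrite xnE.
move=> /negbTE xn xy; rewrite xn => yn.
have {}yn : y n by case: (y n) yn.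
have := cantor_point_bounds x n.+1; have := cantor_point_bounds y n.+1.
rewrite !cantor_psumS (eq_cantor_psum xy) xn yn /= mul1r mul0r addr0.
move=> /andP[? _] /andP[_ ?]; have := gapS n; have := gap_gt0 n => ? ?.
by rewrite distrC; apply: le_trans (ler_norm _); lra.
Qed.

Lemma cantor_point_unit x : 0 <= cantor_point x <= 3^-1.
Proof.
have := cantor_point_bounds x 0; rewrite /cantor_psum big_ord0 add0r.
move=> /andP[-> /= h]; apply: le_trans h _; have := gap_le 0; lra.
Qed.

Lemma first_difference x y n : ~ (forall i, (i < n)%N -> x i = y i) ->
  exists k, [/\ (k < n)%N, (forall i, (i < k)%N -> x i = y i) & x k != y k].
Proof.
elim: n => [|n IH] h; first by exfalso; apply: h.
have [hn|/IH[k [kn kP kxy]]] := pselect (forall i, (i < n)%N -> x i = y i); last first.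
  by exists k; split => //; exact: ltnW.
exists n; split => //; apply/eqP => xyn; apply: h => i.
by rewrite ltnS leq_eqVlt => /predU1P[->//|]; exact: hn.
Qed.

End cantor_points.

(** * Logarithmic potentials with nodes at finite binary words *)

Section potential.
Context {R : realType}.
Implicit Types (x y : nat -> bool) (m n k : nat) (X Y : R).

Definition pad m (s : m.-tuple bool) : nat -> bool := fun i => nth false s i.

Definition prefix_tuple x m : m.-tuple bool := [tuple x i | i < m].

Lemma pad_prefix_tuple x m i : (i < m)%N -> pad (prefix_tuple x m) i = x i.
Proof.
move=> im; rewrite /pad /prefix_tuple.
by rewrite -(tnth_mktuple (fun i : 'I_m => x i) (Ordinal im)) (tnth_nth false).
Qed.

Lemma prefix_tuple_pad m (s : m.-tuple bool) : prefix_tuple (pad s) m = s.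
Proof. by apply: eq_from_tnth => i; rewrite tnth_mktuple (tnth_nth false). Qed.

Lemma eq_prefix_tuple x y m : (forall i, (i < m)%N -> x i = y i) ->
  prefix_tuple x m = prefix_tuple y m.
Proof. by move=> xy; apply: eq_from_tnth => i; rewrite !tnth_mktuple xy. Qed.

(** The regularisation has the scale of the cylinder of [s]: on the Cantor points of that cylinder
    the value is [-2 * loggap m] up to a bounded error. *)
Definition node_log m (s : m.-tuple bool) X Y : R :=
  log_sq (gap m ^+ 2) (X - cantor_point (pad s)) Y.

(** This is [ln (2 (|w|^2 + 1))]; writing [X - 0] lets [submean_log_sq] apply as it stands. *)
Definition majorant X Y : R := ln 2 + log_sq 1 (X - 0) Y.

(* At the point of [x] the layers are summable, since the nodes of its own prefixes
   are left out; at the point of [y] the node of the prefix of [y] alone contributes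
   [-1] to every layer whose words are long enough to separate [x] and [y]. *)
Definition layer x m X Y : R :=
  (loggap m)^-1 * \sum_(s : m.-tuple bool | s != prefix_tuple x m) node_log s X Y.

(* Adding the tail of a geometric series of majorants makes the sequence
   nonincreasing on the whole plane. *)
Definition partial_potential x n X Y : R :=
  \sum_(m < n) layer x m X Y + 2^-1 ^+ n * majorant X Y.

Definition potential x X Y : \bar R :=
  ereal_inf (range (fun n => (partial_potential x n X Y)%:E)).

Lemma submean_partial_potential x n : submean (partial_potential x n).
Proof.
apply: submeanD.
  apply: submean_sum => m _; apply: submeanZ.
    by rewrite invr_ge0 ltW// loggap_gt0.
  by apply: submean_sum => s _; apply: submean_log_sq; rewrite exprn_gt0// gap_gt0.
apply: submeanZ; first by rewrite exprn_ge0// invr_ge0.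
by apply: submeanD; [exact: submean_cst|exact: submean_log_sq].
Qed.

Lemma majorant_ge0 X Y : 0 <= majorant X Y.
Proof.
by apply: addr_ge0; apply: ln_ge0; rewrite ?ler1n// lerDr addr_ge0// sqr_ge0.
Qed.

(** [(X - c)^2 <= 2 X^2 + 2 c^2], and the node [c] lies in [[0, 1/3]]. *)
Lemma node_log_le_majorant m (s : m.-tuple bool) X Y : node_log s X Y <= majorant X Y.
Proof.
have /andP[c0 c1] := @cantor_point_unit R (pad s).
have g0 := @gap_gt0 R m; have g1 := @gap_le R m.
rewrite /majorant /node_log /log_sq subr0.
rewrite -lnM ?posrE//; last by rewrite ltr_wpDl// addr_ge0// sqr_ge0.
have p1 : 0 < (X - cantor_point (pad s)) ^+ 2 + Y ^+ 2 + gap m ^+ 2.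
  by rewrite ltr_wpDl ?exprn_gt0// addr_ge0// sqr_ge0.
rewrite ler_ln ?posrE//; last by rewrite mulr_gt0// ltr_wpDl// addr_ge0// sqr_ge0.
move: c0 c1 g0 g1; move: (cantor_point _) (gap m) => c d; clear; move=> c0 c1 d0 d1.
have : 0 <= (X + c) ^+ 2 by exact: sqr_ge0.
have : 0 <= Y ^+ 2 by exact: sqr_ge0.
nra.
Qed.

(** There are at most [2^m] nodes, each below the majorant, and the weight is at most
    [1 / (2 * 4^m)]. *)
Lemma layer_le x m X Y : layer x m X Y <= 2^-1 ^+ m.+1 * majorant X Y.
Proof.
have G0 := majorant_ge0 X Y; have L0 := @loggap_gt0 R m.
rewrite /layer ler_pdivrMl//.
apply: (@le_trans _ _ (\sum_(s : m.-tuple bool) majorant X Y)).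
  rewrite [leRHS](bigID (fun s => s != prefix_tuple x m))/=.
  apply: ler_wpDr; first exact: sumr_ge0.
  by apply: ler_sum => s _; exact: node_log_le_majorant.
rewrite sumr_const card_tuple card_bool -[leLHS]mulr_natl natrX mulrA ler_wpM2r//.
apply: le_trans (ler_wpM2r _ (loggap_ge m)); last by rewrite exprn_ge0// invr_ge0.
rewrite (_ : 2 * _ * _ = (4 * 2^-1) ^+ m); last by rewrite exprMn exprS; field.
by rewrite (_ : 4 * 2^-1 = 2 :> R)//; field.
Qed.

(** The new layer adds at most [2^-(n+1) * majorant], exactly what the last term loses. *)
Lemma partial_potential_decr x n X Y :
  partial_potential x n.+1 X Y <= partial_potential x n X Y.
Proof.
rewrite /partial_potential big_ord_recr /= -addrA lerD2l.
have := layer_le x n X Y; rewrite exprS; move: (2^-1 ^+ n) (layer _ _ _ _) (majorant _ _).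
move=> u l G; lra.
Qed.

(** Such a word differs from [x] at some [k <= m], so its node is at distance at least
    [2/3 * gap m]. As [gap m <= 1/4], the square of this distance exceeds [gap m ^ 4]. The bound
    involves [loggap m] although the word has length [m.+1]: this gains the ratio
    [loggap m / loggap m.+1]. *)
Lemma node_log_cantor_ge x m (s : m.+1.-tuple bool) : s != prefix_tuple x m.+1 ->
  - (4 * loggap m) <= node_log s (cantor_point x) 0.
Proof.
move=> sx.
have [|k [km kxy xk]] := @first_difference x (pad s) m.+1.
  by move=> /eq_prefix_tuple xs; rewrite xs prefix_tuple_pad eqxx in sx.
have hd := @cantor_point_dist_ge R _ _ _ kxy xk.
have gm j : @gap R (k + j) <= gap k.
  elim: j => [|j IH]; first by rewrite addn0.
  by rewrite addnS; have := @gapS R (k + j); have := @gap_gt0 R (k + j); lra.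
have {}gm := gm (m - k)%N; rewrite subnKC// in gm.
have g0 := @gap_gt0 R m.
rewrite -ler_expR /node_log /log_sq lnK ?posrE; last first.
  by rewrite ltr_wpDl ?exprn_gt0 ?gap_gt0// addr_ge0// sqr_ge0.
rewrite expr0n addr0 -real_normK ?num_real//.
have -> : expR (- (4 * loggap m)) = @gap R m ^+ 4.
  by rewrite /gap -mulrN mulrC -[4]/(4%:R) expRM_natr.
have h : 2 / 3 * gap m <= `|cantor_point x - @cantor_point R (pad s)|.
  by apply: le_trans hd; rewrite ler_wpM2l.
have g1 := @gap_le R m.
have := sqr_ge0 (@gap R m.+1).
move: (`|_|) (gap m) h g0 g1 => D g Dg g0 g1 g2.
have : (2 / 3 * g) ^+ 2 <= D ^+ 2 by rewrite lerXn2r ?nnegrE// ?mulr_ge0 ?ltW//; lra.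
rewrite exprMn (exprM g 2 2).
have : 0 <= g ^+ 2 by exact: sqr_ge0.
have : g ^+ 2 <= 16^-1 by nra.
move: (g ^+ 2) (D ^+ 2) => u v; nra.
Qed.

(** At most [2^(m+1)] terms, each at least [-4 * loggap m], are divided by
    [loggap m.+1 = 8 * 4^m * loggap m]. *)
Lemma layer_self_ge x m : - (2^-1 ^+ m) <= layer x m.+1 (@cantor_point R x) 0.
Proof.
have L0 := @loggap_gt0 R m.+1; have Lm := @loggap_gt0 R m.
rewrite /layer ler_pdivlMl//.
apply: (@le_trans _ _ (\sum_(s : m.+1.-tuple bool | s != prefix_tuple x m.+1)
    - (4 * loggap m))); last first.
  by apply: ler_sum => s; exact: node_log_cantor_ge.
apply: (@le_trans _ _ (\sum_(s : m.+1.-tuple bool) - (4 * loggap m))); last first.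
  rewrite [leLHS](bigID (fun s => s != prefix_tuple x m.+1))/=.
  by rewrite gerDl sumr_le0// => s _; rewrite oppr_le0 mulr_ge0// ltW.
rewrite sumr_const card_tuple card_bool -[leRHS]mulr_natl natrX !mulrN lerN2/=.
rewrite [leRHS](_ : _ = 8 * loggap m * (4 ^+ m * 2^-1 ^+ m)); last by ring.
rewrite -exprMn (_ : 4 * 2^-1 = 2 :> R); last by field.
by rewrite exprS le_eqVlt; apply/orP; left; apply/eqP; ring.
Qed.

Lemma layer0 x X Y : layer x 0 X Y = 0.
Proof. by rewrite /layer big1 ?mulr0// => s; rewrite tuple0 [X in _ != X]tuple0 eqxx. Qed.

Lemma partial_potential_self_ge x n : - 2 <= partial_potential x n (@cantor_point R x) 0.
Proof.
rewrite /partial_potential.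
have : 0 <= 2^-1 ^+ n * majorant (@cantor_point R x) 0.
  by rewrite mulr_ge0 ?majorant_ge0// exprn_ge0// invr_ge0.
suff : - 2 <= \sum_(m < n) layer x m (@cantor_point R x) 0 by lra.
case: n => [|n]; first by rewrite big_ord0; lra.
(* The bound is strengthened to the exact partial sum of the geometric series, so that the induction
   goes through. *)
apply: (@le_trans _ _ (- 2 + 2 * 2^-1 ^+ n)).
  by rewrite lerDl mulr_ge0// exprn_ge0// invr_ge0.
elim: n => [|n IH]; first by rewrite big_ord_recl layer0 big_ord0 expr0; lra.
rewrite big_ord_recr /= exprS.
have := layer_self_ge x n; move: IH; move: (2^-1 ^+ n) (\sum_(_ < _) _) => u v; lra.
Qed.

Lemma node_log_cantor_le0 m (s : m.-tuple bool) y : node_log s (@cantor_point R y) 0 <= 0.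
Proof.
have /andP[c0 c1] := @cantor_point_unit R (pad s).
have /andP[d0 d1] := @cantor_point_unit R y.
have g0 := @gap_gt0 R m; have g1 := @gap_le R m.
apply: ln_le0; rewrite expr0n addr0.
move: c0 c1 d0 d1 g0 g1; move: (cantor_point _) (cantor_point _) (gap _) => c d g; nra.
Qed.

(** The argument of the logarithm is at most [(16/9 + 1) * gap m ^ 2], which is below [gap m]
    because [gap m <= 1/4]. *)
Lemma node_log_prefix_le y m :
  node_log (prefix_tuple y m) (@cantor_point R y) 0 <= - loggap m.
Proof.
have hd : `|@cantor_point R y - cantor_point (pad (prefix_tuple y m))| <= 4 / 3 * gap m.
  by apply: cantor_point_dist_le => i im; rewrite pad_prefix_tuple.
have g0 := @gap_gt0 R m; have g1 := @gap_le R m.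
rewrite -ler_expR /node_log /log_sq lnK ?posrE; last first.
  by rewrite ltr_wpDl ?exprn_gt0// addr_ge0// sqr_ge0.
rewrite expr0n addr0 -real_normK ?num_real// -/(gap m).
move: hd; set D := `|_|; have D0 : 0 <= D by exact: normr_ge0.
move: D D0 (gap m) g0 g1 => D D0 g g0 g1 Dg; nra.
Qed.

Lemma layer_cantor_le0 x y m : layer x m (@cantor_point R y) 0 <= 0.
Proof.
apply: mulr_ge0_le0; first by rewrite invr_ge0 ltW// loggap_gt0.
by apply: sumr_le0 => s _; exact: node_log_cantor_le0.
Qed.

Lemma layer_other_le x y m : prefix_tuple y m != prefix_tuple x m ->
  layer x m (@cantor_point R y) 0 <= -1.
Proof.
move=> yx; rewrite /layer ler_pdivrMl ?loggap_gt0// mulrN1.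
rewrite (bigD1 (prefix_tuple y m))//= -[leRHS]addr0 lerD//.
  exact: node_log_prefix_le.
by apply: sumr_le0 => s _; exact: node_log_cantor_le0.
Qed.

Lemma potential_self x : (-oo < potential x (@cantor_point R x) 0)%E.
Proof.
apply: (@lt_le_trans _ _ (- 2)%:E); first exact: ltNyr.
by apply: le_ereal_inf_tmp => _ [n _ <-]; rewrite lee_fin partial_potential_self_ge.
Qed.

Lemma potential_other x y : x <> y -> potential x (@cantor_point R y) 0 = -oo%E.
Proof.
move=> xy.
have [k xyk] : exists k, x k != y k.
  apply: contrapT => h; apply: xy; apply/funext => k; apply/eqP/negPn/negP => xyk.
  by apply: h; exists k.
have pfx m : prefix_tuple y (k.+1 + m) != prefix_tuple x (k.+1 + m).
  apply: contraNneq xyk => e.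
  by rewrite -(@pad_prefix_tuple x (k.+1 + m)) ?ltn_addr// -e pad_prefix_tuple ?ltn_addr.
(* From length [k.+1] on, every layer contributes at most -1; the earlier ones are at most 0. *)
have h n : partial_potential x (k.+1 + n) (@cantor_point R y) 0 <=
    majorant (@cantor_point R y) 0 - n%:R.
  rewrite /partial_potential addrC lerD//.
    by rewrite ler_piMl ?majorant_ge0// exprn_ile1// ?invr_ge0// invf_le1// ler1n.
  elim: n => [|n IH]; first by rewrite oppr0 sumr_le0// => m _; exact: layer_cantor_le0.
  by rewrite addnS big_ord_recr /= -natr1 opprD lerD//; exact: layer_other_le.
apply: eq_ninfty => A; set G := majorant _ _ in h.
pose N := Num.bound `|G - A|.
apply: (@le_trans _ _ (partial_potential x (k.+1 + N) (@cantor_point R y) 0)%:E).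
  by apply: ereal_inf_lbound; exists (k.+1 + N)%N.
rewrite lee_fin; apply: le_trans (h N) _.
have := archi_boundP (normr_ge0 (G - A)); have := ler_norm (G - A).
by rewrite -/N; lra.
Qed.

End potential.

(** * Continuity of real and imaginary parts *)

Section complex_topology.
Context {R : realType}.
Implicit Types (z w : R[i]).

Lemma complex_lipschitz_continuous (f : R[i] -> R) :
  (forall z w, `|f z - f w|%:C <= `|z - w|) -> continuous f.
Proof.
move=> fL z; apply/(@cvgrPdist_lt _ _ _ _ (nbhs_filter z)) => e e0.
apply/nbhs_ballP; exists e%:C; first by rewrite /= ltcR.
by move=> w; rewrite -ball_normE /= -ltcR; exact: le_lt_trans.
Qed.

Lemma continuous_Re : continuous (@complex.Re R).
Proof.
apply: complex_lipschitz_continuous => z w.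
by rewrite -raddfB; exact: normc_ge_Re.
Qed.

Lemma continuous_Im : continuous (@complex.Im R).
Proof.
have Im_le (u : R[i]) : `|complex.Im u|%:C <= `|u|.
  by rewrite normc_def lecR -sqrtr_sqr ler_wsqrtr// lerDr sqr_ge0.
apply: complex_lipschitz_continuous => z w.
by have := Im_le (z - w); case: z w => [z1 z2] [w1 w2].
Qed.

End complex_topology.

(** * Plurisubharmonic functions and plurifinely open sets *)

Section psh_potential.
Context {R : realType}.

Definition cpotential (x : nat -> bool) (w : R[i]) : \bar R :=
  potential x (complex.Re w) (complex.Im w).

Lemma cpotential_lty x w : (cpotential x w < +oo)%E.
Proof.
apply: (@le_lt_trans _ _ (partial_potential x 0 (complex.Re w) (complex.Im w))%:E).
  by apply: ereal_inf_lbound; exists 0%N.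
exact: ltry.
Qed.

(** An infimum of continuous functions is upper semicontinuous. The map [g] serves both for a
    coordinate of C^n and for an affine map of C. *)
Lemma usc_cpotential (T : topologicalType) (g : T -> R[i]) (W : set T) x :
  continuous g -> usc_on W (fun t => cpotential x (g t)).
Proof.
move=> cg t _ a /ereal_inf_lt[_ [n _ <-]]; rewrite lte_fin => ha.
have cf : {for t, continuous (fun t =>
    partial_potential x n (complex.Re (g t)) (complex.Im (g t)))}.
  apply: continuous_submean; first exact: submean_partial_potential.
    by apply: (@continuous_comp _ _ _ g (@complex.Re R) t); [exact: cg|exact: continuous_Re].
  by apply: (@continuous_comp _ _ _ g (@complex.Im R) t); [exact: cg|exact: continuous_Im].
apply: filterS (cvgr_lt _ cf _ ha) => s hs.
apply: (@le_lt_trans _ _ (partial_potential x n (complex.Re (g s)) (complex.Im (g s)))%:E).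
  by apply: ereal_inf_lbound; exists n.
by rewrite lte_fin.
Qed.

(** The affine map [l |-> alpha + l * beta] carries the circle to a curve of the shape used in
    [submean], also when [beta = 0]. The inequality then passes from the partial potentials to their
    infimum by [integral_inf_ge]. *)
Lemma cpotential_circle_mean x (alpha beta c : R[i]) (r : R) :
  (cpotential x (alpha + c * beta)%R <=
   circle_mean (fun l => cpotential x (alpha + l * beta)%R) c r)%E.
Proof.
case: alpha beta c => [a1 a2] [b1 b2] [c1 c2].
set alpha := a1 +i* a2; set beta := b1 +i* b2; set c := c1 +i* c2.
pose p1 := complex.Re (alpha + c * beta); pose p2 := complex.Im (alpha + c * beta).
pose q1 := r * complex.Re beta; pose q2 := r * complex.Im beta.
have E t : cpotential x (alpha + circle_point c r t * beta) =
    potential x (p1 + (q1 * cos t - q2 * sin t)) (p2 + (q1 * sin t + q2 * cos t)).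
  have idRe (a b b' d d' u v : R) : a + ((d + r * u) * b - (d' + r * v) * b') =
    a + (d * b - d' * b') + (r * b * u - r * b' * v) by ring.
  have idIm (a b b' d d' u v : R) : a + ((d + r * u) * b' + (d' + r * v) * b) =
    a + (d * b' + d' * b) + (r * b * v + r * b' * u) by ring.
  have eqRe : complex.Re (alpha + circle_point c r t * beta) =
    p1 + (q1 * cos t - q2 * sin t) by exact: idRe.
  have eqIm : complex.Im (alpha + circle_point c r t * beta) =
    p2 + (q1 * sin t + q2 * cos t) by exact: idIm.
  by rewrite /cpotential eqRe eqIm.
have pi2 : 0 < 2 * pi :> R by rewrite mulr_gt0// pi_gt0.
suff h : ((2 * pi)%:E * potential x p1 p2 <= \int[lebesgue_measure]_(t in `[0%R, (2 * pi)%R])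
    potential x (p1 + (q1 * cos t - q2 * sin t))%R (p2 + (q1 * sin t + q2 * cos t))%R)%E.
  rewrite /circle_mean; under eq_integral do rewrite E.
  rewrite -[leLHS]mul1e -[X in (X%:E * _)%E](@mulVf _ (2 * pi)) ?gt_eqF// EFinM -muleA.
  by apply: lee_wpmul2l => //; rewrite lee_fin invr_ge0 ltW.
apply: integral_inf_ge.
- by move=> n; apply: continuous_submean_circle; exact: submean_partial_potential.
- by move=> n t; exact: partial_potential_decr.
- move=> n.
  apply: (@le_trans _ _ ((2 * pi)%:E * (partial_potential x n p1 p2)%:E)%E).
    apply: lee_wpmul2l; first by rewrite lee_fin ltW.
    by apply: ereal_inf_lbound; exists n.
  have sn := @submean_partial_potential R x n.
  rewrite -[leRHS]fineK; last first.
    apply: (@integrable_fin_num _ _ _ lebesgue_measure) => //.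
    exact/continuous_itv_integrable/continuous_submean_circle.
  by rewrite -EFinM lee_fin; exact: sn.2.
Qed.

Lemma psh_cpotential x n (i : 'I_n) :
  plurisubharmonic setT (fun z : 'rV[R[i]]_n => cpotential x (z 0 i)).
Proof.
split=> [z _||a b]; first exact: cpotential_lty.
  by apply: usc_cpotential; exact: coord_continuous.
rewrite (_ : (fun l => _) = (fun l : R[i] => cpotential x (a 0 i + l * b 0 i))); last first.
  by apply/funext => l; rewrite !mxE.
split=> [l _||c r r0 _]; [exact: cpotential_lty| |exact: cpotential_circle_mean].
apply: usc_cpotential => l.
apply: (@continuousD R[i] R[i] R[i] (fun=> a 0 i) (fun l => l * b 0 i)).
  exact: cst_continuous.
apply: (@continuousM R[i] R[i] id (fun=> b 0 i)); last exact: cst_continuous.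
by [].
Qed.

Lemma plurifinely_open_psh n (f : 'rV[R[i]]_n -> \bar R) (U : set (\bar R)) :
  plurisubharmonic setT f -> open U -> plurifinely_open (f @^-1` U).
Proof.
move=> pf oU; rewrite /plurifinely_open openE => z Uz.
pose i : {f : 'rV[R[i]]_n -> \bar R | plurisubharmonic setT f} := exist _ f pf.
(* The supremum topology refines the initial topology of each of its members, here that of [f]. *)
have /cvg_sup/(_ i) : nbhs (z : plurifine R n) --> (z : plurifine R n) by exact: cvg_id.
apply; apply: open_nbhs_nbhs; split => //.
by exists U.
Qed.

End psh_potential.

(** * Borel codes and diagonalisation *)

Section borel_codes.

Inductive bcode : Type :=
| BEmpty
| BCyl of seq bool
| BCompl of bcode
| BUnion of (nat -> bcode).

Fixpoint bcode_set (c : bcode) : set (nat -> bool) :=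
  match c with
  | BEmpty => set0
  | BCyl s => [set x | forall i, (i < size s)%N -> x i = nth false s i]
  | BCompl c => ~` bcode_set c
  | BUnion f => \bigcup_n bcode_set (f n)
  end.

(* A code is determined by the labelling of the nodes of its well-founded tree. *)
Fixpoint bcode_tree (c : bcode) (w : seq nat) : nat :=
  match c, w with
  | BEmpty, _ => 0
  | BCyl s, _ => (pickle s).+3
  | BCompl _, [::] => 1
  | BCompl c, _ :: w => bcode_tree c w
  | BUnion _, [::] => 2
  | BUnion f, n :: w => bcode_tree (f n) w
  end.

Lemma bcode_tree_inj : injective bcode_tree.
Proof.
move=> c; elim: c => [|s|c IH|f IH] [|s'|c'|f'] e; have := congr1 (@^~ [::]) e => //=.
- by case=> /(pcan_inj (@pickleK _)) ->.
- move=> _; congr BCompl; apply: IH; apply/funext => w.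
  exact: (congr1 (@^~ (0%N :: w)) e).
- move=> _; congr BUnion; apply/funext => n; apply: IH; apply/funext => w.
  exact: (congr1 (@^~ (n :: w)) e).
Qed.

(** The indicator function of the graph of [bcode_tree c], with the pairs of a node and a label
    enumerated by [pickle]. *)
Definition bcode_point (c : bcode) : nat -> bool := fun k =>
  if unpickle k is Some (w, v) then bcode_tree c w == v else false.

Lemma bcode_point_inj : injective bcode_point.
Proof.
move=> c c' e; apply: bcode_tree_inj; apply/funext => w.
have := congr1 (@^~ (pickle (w, bcode_tree c w))) e.
by rewrite /bcode_point pickleK eqxx => /esym/eqP.
Qed.

Definition bdiag : set (nat -> bool) :=
  [set x | exists2 c, bcode_point c = x & ~ bcode_set c x].

(** Cantor's diagonal argument at the point of [c]. By injectivity no other code can put this point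
    into [bdiag]. *)
Lemma bdiag_not_coded c : bcode_set c <> bdiag.
Proof.
move=> e; have h : ~ bcode_set c (bcode_point c).
  by move=> hc; move: (hc); rewrite e => -[c' /bcode_point_inj ->].
by apply: (h); rewrite e; exists c.
Qed.

(** The sets whose preimage has a code form a sigma-algebra. It contains the open sets, since the
    hypothesis on [f] is continuity expressed through prefixes. *)
Lemma preimage_borel_coded (T : topologicalType) (f : (nat -> bool) -> T) (A : set T) :
  (forall U x, open U -> U (f x) ->
     exists k, forall y, (forall i, (i < k)%N -> y i = x i) -> U (f y)) ->
  borel_set A -> exists c, bcode_set c = f @^-1` A.
Proof.
move=> cf; apply: (smallest_sub (X := [set B | exists c, bcode_set c = f @^-1` B])).
  split.
  - by exists BEmpty; rewrite preimage_set0.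
  - by move=> B [c cB]; exists (BCompl c); rewrite /= cB setTD preimage_setC.
  - move=> B /choice[c cB]; exists (BUnion c); rewrite preimage_bigcup /=.
    by apply: eq_bigcup => // i _; exact: cB.
move=> U oU /=.
(* The preimage of [U] is the union of the countably many cylinders it contains; all other indices
   give the empty set. *)
pose c n := if unpickle n is Some s then
    if `[< bcode_set (BCyl s) `<=` f @^-1` U >] then BCyl s else BEmpty
  else BEmpty.
exists (BUnion c); apply/seteqP; split => [x [n _]|x Ux].
  rewrite /c; case: unpickle => [s|//]; case: asboolP => // + xs.
  exact.
have [k kU] := cf _ _ oU Ux.
exists (pickle (mkseq x k)) => //; rewrite /c pickleK.
have sE i : (i < k)%N -> nth false (mkseq x k) i = x i by move=> ik; rewrite nth_mkseq.
case: asboolP => [_|[]]; first by move=> i; rewrite size_mkseq => ik; rewrite sE.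
by move=> y hy; apply: kU => i ik; rewrite hy ?size_mkseq// sE.
Qed.

End borel_codes.

(** * The Cantor set on the diagonal of C^n *)

Section non_borel.
Context {R : realType} (n : nat).

Definition cantor_vector (x : nat -> bool) : 'rV[R[i]]_n := const_mx (cantor_point x)%:C.

Lemma cantor_vector_continuous (U : set 'rV[R[i]]_n) x : open U -> U (cantor_vector x) ->
  exists k, forall y, (forall i, (i < k)%N -> y i = x i) -> U (cantor_vector y).
Proof.
move=> oU Ux; have /nbhs_ballP[e e0 eU] : nbhs (cantor_vector x) U.
  exact: open_nbhs_nbhs.
move: (e0); rewrite /= ltcE /= => /andP[/eqP ei er].
(* A positive element of [R[i]] is real, so the radius can be compared with gaps. *)
have eE : e = (complex.Re e)%:C by move: ei; case: (e) => a b /= ->.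
have [k ke] := gap_small (divr_gt0 er (ltr0n _ 2 : 0 < 2 :> R)).
exists k => y yx; apply: eU; split; first exact: e0.
move=> i j; rewrite !mxE -ball_normE /= eE -raddfB /= normc_def /= expr0n addr0 sqrtr_sqr ltcR.
apply: le_lt_trans (@cantor_point_dist_le R x y k _) _; first by move=> l lk; rewrite yx.
by have := @gap_gt0 R k; lra.
Qed.

End non_borel.

(** * The non-Borel plurifinely open set, and Borel superlevel sets *)

Section main.
Context {R : realType} (n : nat).

Lemma plurifinely_open_non_borel : (1 <= n)%N ->
  exists Omega : set 'rV[R[i]]_n, plurifinely_open Omega /\ ~ borel_set Omega.
Proof.
move=> n0; pose j : 'I_n := Ordinal n0.
exists (\bigcup_(x in bdiag) [set z : 'rV[R[i]]_n | (-oo < cpotential x (z 0%R j))%E]); split.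
  apply: (@bigcup_open (plurifine R n)) => x _.
  exact: (plurifinely_open_psh (psh_cpotential x j) (@open_ereal_gt_ereal R -oo%E)).
move=> /(@preimage_borel_coded _ (@cantor_vector R n) _ (@cantor_vector_continuous R n)).
move=> [c cE]; apply: (@bdiag_not_coded c); rewrite cE.
(* The preimage under [cantor_vector] is exactly [bdiag]: at the vector of [y], only the potential
   of [y] itself is not [-oo]. *)
apply/seteqP; split => [y [x xS /=]|x xS].
  rewrite mxE /cpotential /=; have [<-//|xy] := pselect (x = y).
  by rewrite potential_other.
by exists x => //=; rewrite mxE; exact: potential_self.
Qed.

Lemma euclidean_ball_open (c : 'rV[R[i]]_n) (r : R) : open (euclidean_ball c r).
Proof.
(* The defining inequality lives in [R[i]]; the real-valued [Q] turns the ball into a preimage of an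
   open half-line. *)
pose Q (z : 'rV[R[i]]_n) : R :=
  \sum_i (complex.Re (z 0 i - c 0 i) ^+ 2 + complex.Im (z 0 i - c 0 i) ^+ 2).
have -> : euclidean_ball c r = Q @^-1` [set q | q < r ^+ 2].
  have QE z : (Q z)%:C = \sum_i `|z 0 i - c 0 i| ^+ 2.
    by rewrite rmorph_sum; apply: eq_bigr => i _; exact: add_Re2_Im2.
  by apply/funext => z; rewrite /euclidean_ball /= -QE ltcR.
apply: open_comp; last exact: open_lt.
suff cQ : continuous Q by move=> z _; exact: cQ.
apply: continuous_big => [|i _ z]; first exact: add_continuous.
have cz : {for z, continuous (fun z : 'rV[R[i]]_n => z 0 i - c 0 i)}.
  apply: (@continuousB R[i] R[i] _ (fun z : 'rV[R[i]]_n => z 0 i) (fun=> c 0 i)).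
    exact: coord_continuous.
  exact: cst_continuous.
have cRe : {for z, continuous (fun z : 'rV[R[i]]_n => complex.Re (z 0 i - c 0 i))}.
  by apply: (@continuous_comp _ _ _ _ (@complex.Re R) z); [exact: cz|exact: continuous_Re].
have cIm : {for z, continuous (fun z : 'rV[R[i]]_n => complex.Im (z 0 i - c 0 i))}.
  by apply: (@continuous_comp _ _ _ _ (@complex.Im R) z); [exact: cz|exact: continuous_Im].
have csq (f : 'rV[R[i]]_n -> R) : {for z, continuous f} ->
    {for z, continuous (fun z => f z ^+ 2)}.
  move=> cf; apply: (@continuous_comp _ _ _ f (fun q : R => q ^+ 2) z) => //.
  exact: exprn_continuous.
exact: (@continuousD _ _ _ _ _ z) (csq _ cRe) (csq _ cIm).
Qed.

(** The condition [f > a] is the union over [k] of the conditions [f >= a + 1/(k+1)]. Each of these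
    cuts out [W] minus a sublevel set that is open by upper semicontinuity. *)
Lemma borel_usc_superlevel (W : set 'rV[R[i]]_n) (f : 'rV[R[i]]_n -> \bar R) (a : R) :
  open W -> usc_on W f -> borel_set [set z | W z /\ (a%:E < f z)%E].
Proof.
move=> oW uf.
pose S := g_sigma_algebraType (@open 'rV[R[i]]_n).
have mopen (U : set S) : @open 'rV[R[i]]_n U -> measurable U by exact: sub_sigma_algebra.
suff : measurable ([set z | W z /\ (a%:E < f z)%E] : set S) by [].
have -> : [set z | W z /\ (a%:E < f z)%E] =
    \bigcup_k (W `\` [set z | W z /\ (f z < (a + k.+1%:R^-1)%:E)%E]).
  apply/seteqP; split => z.
    move=> [Wz az].
    have [k ak] : exists k, ((a + k.+1%:R^-1)%:E <= f z)%E.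
      case: (f z) az => [v| |//]; last by exists 0%N; rewrite leey.
      by rewrite lte_fin => /ltr_add_invr[k ak]; exists k; rewrite lee_fin ltW.
    exists k => //; split => // -[_]; rewrite ltNge; exact/negP/negPn.
  move=> [k _ [Wz /not_andP[//|/negP]]]; rewrite -leNgt => h; split => //.
  by apply: lt_le_trans h; rewrite lte_fin ltrDl.
apply: bigcup_measurable => k _; apply: measurableD; first exact: mopen.
apply: mopen; rewrite openE => z [Wz fz].
have oWz : nbhs z W by exact: open_nbhs_nbhs.
by apply: filterS2 oWz (uf _ Wz _ fz) => y Wy fy; split.
Qed.

Lemma borel_superlevel_union (J : set nat) (c : nat -> 'rV[R[i]]_n) (r : nat -> R)
    (phi : nat -> 'rV[R[i]]_n -> \bar R) :
  (forall j, J j -> usc_on (euclidean_ball (c j) (r j)) (phi j)) ->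
  borel_set (\bigcup_(j in J)
    [set z | euclidean_ball (c j) (r j) z /\ (-1 < phi j z)%E]).
Proof.
move=> uphi.
apply: (@bigcup_measurable _ (g_sigma_algebraType (@open 'rV[R[i]]_n))) => j Jj.
by apply: borel_usc_superlevel; [exact: euclidean_ball_open|exact: uphi].
Qed.

End main.

Theorem mainTheorem1 (R : realType) (n : nat) (hn : (1 <= n)%N) :
  (exists Omega : set 'rV[R[i]]_n,
     plurifinely_open Omega /\ ~ borel_set Omega) /\
  ~ (forall Omega : set 'rV[R[i]]_n, plurifinely_open Omega ->
       exists (J : set nat) (c : nat -> 'rV[R[i]]_n) (r : nat -> R)
              (phi : nat -> 'rV[R[i]]_n -> \bar R),
         (forall j, J j ->
            [/\ 0 < r j,
                plurisubharmonic (euclidean_ball (c j) (r j)) (phi j) &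
                forall z, euclidean_ball (c j) (r j) z -> (phi j z < 0)%E]) /\
         Omega = \bigcup_(j in J)
           [set z | euclidean_ball (c j) (r j) z /\ (-1 < phi j z)%E]).
Proof.
have [W [oW nbW]] := @plurifinely_open_non_borel R n hn.
split; first by exists W.
move=> /(_ _ oW)[J [c [r [phi [hphi WE]]]]]; apply: nbW; rewrite WE.
by apply: borel_superlevel_union => j /hphi[_ [_ uphi _] _].
Qed.
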